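(* Let $c_0,\tau_0>0$ and let the thermo-viscous attenuation coefficient be $$\alpha^*_{tv}(\omega)=\frac{-i\omega}{c_0\sqrt{1-i\tau_0\omega}}+\frac{i\omega}{c_0},\qquad\omega\in\mathbb{R}.$$ Then the kernel $K(\vec x,t)=\frac{1}{\sqrt{2\pi}}\mathcal{F}^{-1}\{e^{-\alpha^*_{tv}(\cdot)|\vec x|}\}(t)$ violates causality.
   Context: Fourier convention: $\mathcal{F}^{-1}\{\hat f\}(t)=\frac{1}{\sqrt{2\pi}}\int_{\mathbb{R}}e^{-i\omega t}\hat f(\omega)\,d\omega$ (tempered distributions). The square root of a complex number is the root with non-negative real part. $K$ is causal if $t\mapsto K(\vec x,t)$ vanishes for $t<0$ for every $\vec x\in\mathbb{R}^3$. *)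

(* Defs.v *)
From Stdlib Require Import Reals.
From Coquelicot Require Import Coquelicot.
Open Scope R_scope.

Definition Csqrt_pr (z : C) : C :=
  let a := Re z in let b := Im z in let m := Cmod z in
  (sqrt ((m + a) / 2), if Rlt_dec b 0 then - sqrt ((m - a) / 2) else sqrt ((m - a) / 2)).

Definition Cexp (z : C) : C := (exp (Re z) * cos (Im z), exp (Re z) * sin (Im z)).

Definition alpha_tv (c0 tau0 w : R) : C :=
  ((- (Ci * RtoC w)) / (RtoC c0 * Csqrt_pr (1 - Ci * RtoC (tau0 * w))) + (Ci * RtoC w) / RtoC c0)%C.

Definition norm3 (x : R * R * R) : R :=
  let '(x1, x2, x3) := x in sqrt (x1 ^ 2 + x2 ^ 2 + x3 ^ 2).

Definition symbol (c0 tau0 : R) (x : R * R * R) (w : R) : C :=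
  Cexp (- (alpha_tv c0 tau0 w * RtoC (norm3 x)))%C.

(* inverse Fourier transform with the paper's convention,
   (F^{-1} phi)(w) = 1/sqrt(2 pi) int e^{-i w t} phi(t) dt *)
Definition ift (phi : R -> C) (w : R) : C :=
  (RtoC (/ sqrt (2 * PI)) *
   @RInt_gen C_R_CompleteNormedModule (fun t => Cexp (- (Ci * RtoC (w * t)))%C * phi t)
            (Rbar_locally m_infty) (Rbar_locally p_infty))%C.

Definition test_fun_neg (phi : R -> R) : Prop :=
  (forall n t, ex_derive_n phi n t) /\
  exists a b, b < 0 /\ forall t, (t < a \/ b < t) -> phi t = 0.

(* <K(x,.), phi> = L, where K(x,.) = 1/sqrt(2 pi) F^{-1}{symbol}, the
   tempered distribution F^{-1}{g} acting by <F^{-1} g, phi> = <g, F^{-1} phi> *)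
Definition kernel_pairing (c0 tau0 : R) (x : R * R * R) (phi : R -> R) (L : C) : Prop :=
  @is_RInt_gen C_R_NormedModule (fun w => (RtoC (/ sqrt (2 * PI)) * symbol c0 tau0 x w * ift (fun t => RtoC (phi t)) w)%C)
              (Rbar_locally m_infty) (Rbar_locally p_infty) L.

Definition kernel_causal (c0 tau0 : R) : Prop :=
  forall (x : R * R * R) (phi : R -> R) (L : C),
    test_fun_neg phi -> kernel_pairing c0 tau0 x phi L -> L = 0%C.

(* Main.v *)
Require Import Defs.
From Stdlib Require Import Reals.
From Coquelicot Require Import Coquelicot.
From Stdlib Require Import Lra Lia.
Open Scope R_scope.

(** The idea is a central limit theorem.  The kernel [K(x,.)] has mass [1],
    mean [0] and variance [tau0 |x| / c0].  Hence, for [|x|] of order [d^2],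
    rescaling time by [d -> oo] turns it into a Gaussian, which charges the
    negative half-line.  To detect this, pair [K(x,.)] with [bump (t / d)], where
    [bump > 0] on (-2,-1).  After the substitution [w = v / d], the symbol is
    [exp (- 4 v^2 / (q (q + 1)))] with [q = sqrt (1 - i tau0 v / d)] for
    [|x| = 4 c0 d^2 / tau0].  It is bounded by [1] and converges to
    [exp (- 2 v^2)] locally uniformly, while the transform of [bump] is
    [O(1 / (1 + v^2))].  So the pairing converges, up to a positive constant, to
    the integral of [exp (- 2 v^2)] against that transform, and this is positive
    because the real part of the transform at [v] is at least
    [(1 - 2 v^2)] times the mass of [bump]. *)

(** * A smooth bump function *)

(** A tower of [n] explicit derivatives. In this form, closure under sums, products and affine
    substitution is a plain induction on [n], with no Leibniz formula for iterated derivatives. *)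
Fixpoint smooth_upto (n : nat) (f : R -> R) : Prop :=
  match n with
  | O => True
  | S m => exists f', (forall x, is_derive f x (f' x)) /\ smooth_upto m f'
  end.

Lemma smooth_upto_ext n f g :
  (forall x, f x = g x) -> smooth_upto n f -> smooth_upto n g.
Proof.
  destruct n as [|n]; [easy|].
  intros E [f' [Hd Hs]]; exists f'; split; [|easy].
  intros x; apply is_derive_ext with f; auto.
Qed.

Lemma smooth_upto_pred n f : smooth_upto (S n) f -> smooth_upto n f.
Proof.
  revert f; induction n as [|n IH]; intros f [f' [Hd Hs]]; [easy|].
  exists f'; auto.
Qed.

Lemma smooth_upto_plus n f g :
  smooth_upto n f -> smooth_upto n g -> smooth_upto n (fun x => f x + g x).
Proof.
  revert f g; induction n as [|n IH]; [easy|].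
  intros f g [f' [Hf Sf]] [g' [Hg Sg]].
  exists (fun x => f' x + g' x); split; [|now apply IH].
  intros x; apply (is_derive_plus f g); auto.
Qed.

Lemma smooth_upto_scal n k f :
  smooth_upto n f -> smooth_upto n (fun x => k * f x).
Proof.
  revert f; induction n as [|n IH]; [easy|].
  intros f [f' [Hf Sf]].
  exists (fun x => k * f' x); split; [|now apply IH].
  intros x; apply is_derive_scal; auto.
Qed.

Lemma smooth_upto_mult n f g :
  smooth_upto n f -> smooth_upto n g -> smooth_upto n (fun x => f x * g x).
Proof.
  revert f g; induction n as [|n IH]; [easy|].
  intros f g Hf Hg.
  (* Each term of the product rule keeps one factor undifferentiated, so [f] and [g] are also needed
     at level [n]. *)
  generalize (smooth_upto_pred n f Hf) (smooth_upto_pred n g Hg); intros Pf Pg.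
  destruct Hf as [f' [Df Sf]], Hg as [g' [Dg Sg]].
  exists (fun x => f' x * g x + f x * g' x); split.
  - intros x; apply (is_derive_mult f g); auto.
    intros; apply Rmult_comm.
  - apply smooth_upto_plus; auto.
Qed.

Lemma smooth_upto_affine n a b f :
  smooth_upto n f -> smooth_upto n (fun x => f (a * x + b)).
Proof.
  revert f; induction n as [|n IH]; [easy|].
  intros f [f' [Hf Sf]].
  exists (fun x => a * f' (a * x + b)); split.
  - intros x.
    apply (is_derive_comp f (fun x => a * x + b)); [apply Hf|].
    auto_derive; [easy|ring].
  - apply smooth_upto_scal; auto.
Qed.

Lemma smooth_upto_Derive n f : smooth_upto (S n) f -> smooth_upto n (Derive f).
Proof.
  intros [f' [Hd Hs]].
  apply smooth_upto_ext with f'; [|easy].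
  intros x; symmetry; now apply is_derive_unique.
Qed.

Lemma smooth_upto_ex_derive n f x : smooth_upto (S n) f -> ex_derive f x.
Proof. intros [f' [Hd _]]; now exists (f' x). Qed.

Lemma smooth_upto_ex_derive_n n f x : smooth_upto n f -> ex_derive_n f n x.
Proof.
  destruct n as [|n]; [easy|].
  intros Hs; simpl.
  (* The tower starts from [f], so the induction removes derivatives from the inside, passing from
     [f] to [Derive f]. *)
  assert (H : smooth_upto 1 (Derive_n f n)).
  { revert f Hs; induction n as [|n IH]; intros f Hs.
    - apply Hs.
    - apply smooth_upto_ext with (Derive_n (Derive f) n).
      + intros y; change (Derive f) with (Derive_n f 1).
        rewrite Derive_n_comp, Nat.add_1_r; reflexivity.
      + apply IH, smooth_upto_Derive, Hs. }
  now apply smooth_upto_ex_derive with O.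
Qed.

(** The functions [x^-k exp (-1/x)], extended by [0], are stable under
    derivation up to linear combinations. *)
Definition flat (k : nat) (x : R) : R :=
  if Rle_dec x 0 then 0 else (/ x) ^ k * exp (- / x).

Lemma flat_neg k x : x <= 0 -> flat k x = 0.
Proof. intros H; unfold flat; destruct (Rle_dec x 0); [easy|contradiction]. Qed.

Lemma flat_pos_eq k x : 0 < x -> flat k x = (/ x) ^ k * exp (- / x).
Proof. intros H; unfold flat; destruct (Rle_dec x 0); [lra|easy]. Qed.

Lemma flat_pos k x : 0 < x -> 0 < flat k x.
Proof.
  intros H; rewrite flat_pos_eq by easy.
  apply Rmult_lt_0_compat; [|apply exp_pos].
  apply pow_lt; now apply Rinv_0_lt_compat.
Qed.

Lemma exp_INR_mult n x : exp (INR n * x) = exp x ^ n.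
Proof.
  induction n as [|n IH]; [rewrite Rmult_0_l; apply exp_0|].
  rewrite S_INR, Rmult_plus_distr_r, Rmult_1_l, exp_plus, IH; simpl; ring.
Qed.

(** This is [t <= exp t] at [t = y / (n + 1)], raised to the power [n + 1]. *)
Lemma pow_exp_neg_bound n y :
  0 <= y -> y ^ (S n) * exp (- y) <= INR (S n) ^ (S n).
Proof.
  intros Hy.
  assert (Hn : 0 < INR (S n)) by (apply lt_0_INR; lia).
  assert (E : exp y = exp (y / INR (S n)) ^ (S n)).
  { rewrite <- exp_INR_mult; f_equal; field; lra. }
  rewrite exp_Ropp.
  apply Rmult_le_reg_r with (exp y); [apply exp_pos|].
  rewrite Rmult_assoc, Rinv_l by (apply Rgt_not_eq, exp_pos).
  rewrite Rmult_1_r, E, <- Rpow_mult_distr.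
  apply pow_incr; split; [easy|].
  apply Rle_trans with (INR (S n) * (y / INR (S n))).
  - right; field; lra.
  - apply Rmult_le_compat_l; [lra|].
    generalize (exp_ineq1_le (y / INR (S n))); lra.
Qed.

(** With [y = 1 / x], [flat k x] equals [y^(k+2) exp (-y) x^2] for [x > 0], and [y^(k+2) exp (-y)]
    is bounded. The square makes the derivative at the origin vanish. *)
Lemma flat_quadratic_bound k : exists c, 0 < c /\ forall x, Rabs (flat k x) <= c * x ^ 2.
Proof.
  exists (INR (S (S k)) ^ (S (S k))); split.
  - apply pow_lt, lt_0_INR; lia.
  - intros x; destruct (Rle_dec x 0) as [H|H].
    + rewrite flat_neg, Rabs_R0 by easy.
      apply Rmult_le_pos; [apply pow_le, pos_INR|nra].
    + assert (Hx : 0 < x) by lra.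
      rewrite Rabs_pos_eq by (now apply Rlt_le, flat_pos).
      rewrite flat_pos_eq by easy.
      assert (Hi : 0 < / x) by (now apply Rinv_0_lt_compat).
      generalize (pow_exp_neg_bound (S k) (/ x) (Rlt_le _ _ Hi)); intros B.
      apply Rle_trans with ((/ x) ^ S (S k) * exp (- / x) * x ^ 2).
      * right; simpl; field; lra.
      * apply Rmult_le_compat_r; [nra|easy].
Qed.

Lemma is_derive_quadratic_bound (f : R -> R) c :
  0 < c -> f 0 = 0 -> (forall x, Rabs (f x) <= c * x ^ 2) -> is_derive f 0 0.
Proof.
  intros Hc F0 Hf.
  apply is_derive_Reals; intros eps Heps.
  assert (Hd : 0 < eps / c) by (now apply Rdiv_lt_0_compat).
  exists (mkposreal _ Hd); simpl; intros h Hh Hlt.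
  rewrite Rplus_0_l, F0, !Rminus_0_r.
  unfold Rdiv; rewrite Rabs_mult, Rabs_inv.
  assert (Ha : 0 < Rabs h) by (now apply Rabs_pos_lt).
  apply Rle_lt_trans with (c * Rabs h).
  - apply Rmult_le_reg_r with (Rabs h); [easy|].
    rewrite Rmult_assoc, Rinv_l by lra.
    generalize (Hf h); rewrite <- (pow2_abs h); lra.
  - apply Rmult_lt_reg_l with (/ c); [now apply Rinv_0_lt_compat|].
    rewrite <- Rmult_assoc, Rinv_l, Rmult_1_l by lra.
    unfold Rdiv in Hlt; lra.
Qed.

Lemma is_derive_flat k x :
  is_derive (flat k) x (flat (S (S k)) x + - INR k * flat (S k) x).
Proof.
  destruct (Rtotal_order x 0) as [H|[H|H]].
  - rewrite !flat_neg by lra.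
    replace (0 + - INR k * 0) with 0 by ring.
    apply is_derive_ext_loc with (fun _ => 0).
    + apply locally_interval with m_infty 0; simpl; try easy.
      intros y _ Hy; rewrite flat_neg; lra.
    + apply @is_derive_const.
  - subst x; rewrite !flat_neg by lra.
    replace (0 + - INR k * 0) with 0 by ring.
    destruct (flat_quadratic_bound k) as [c [Hc Hb]].
    apply is_derive_quadratic_bound with c; auto.
    apply flat_neg; lra.
  - rewrite !flat_pos_eq by easy.
    apply is_derive_ext_loc with (fun x => (/ x) ^ k * exp (- / x)).
    + apply locally_interval with 0 p_infty; simpl; try easy.
      intros y Hy _; rewrite flat_pos_eq; easy.
    + auto_derive; [lra|].
      (* The derivative of the power carries the exponent [pred k], hence the case split. *)
      destruct k as [|k]; [simpl; field; lra|].
      change (pred (S k)) with k; rewrite <- !tech_pow_Rmult; field; lra.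
Qed.

Lemma smooth_upto_flat n k : smooth_upto n (flat k).
Proof.
  revert k; induction n as [|n IH]; intros k; [easy|].
  exists (fun x => flat (S (S k)) x + - INR k * flat (S k) x); split.
  - intros x; apply is_derive_flat.
  - apply smooth_upto_plus; [|apply smooth_upto_scal]; apply IH.
Qed.

(** The support lies in [-2,-1], so every dilate [bump (t / d)] with [d > 0] tests only negative
    times. *)
Definition bump (t : R) : R := flat 0 (t + 2) * flat 0 (- t - 1).

Lemma smooth_upto_bump n : smooth_upto n bump.
Proof.
  apply smooth_upto_ext with
    (fun t => flat 0 (1 * t + 2) * flat 0 (- 1 * t + - 1)).
  - intros t; unfold bump; do 2 f_equal; ring.
  - apply smooth_upto_mult; apply smooth_upto_affine, smooth_upto_flat.
Qed.

Lemma bump_pos t : - 2 < t < - 1 -> 0 < bump t.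
Proof. intros H; apply Rmult_lt_0_compat; apply flat_pos; lra. Qed.

Lemma bump_out t : t <= - 2 \/ - 1 <= t -> bump t = 0.
Proof.
  intros [H|H]; unfold bump.
  - rewrite (flat_neg 0 (t + 2)) by lra; ring.
  - rewrite (flat_neg 0 (- t - 1)) by lra; ring.
Qed.

Lemma bump_nonneg t : 0 <= bump t.
Proof.
  destruct (Rlt_dec (- 2) t); [destruct (Rlt_dec t (- 1))|].
  - apply Rlt_le, bump_pos; lra.
  - rewrite bump_out; lra.
  - rewrite bump_out; lra.
Qed.

(** * Improper and oscillatory integrals *)

Lemma continuous_comp_real (f g : R -> R) x :
  continuous f x -> continuous g (f x) -> continuous (fun y => g (f y)) x.
Proof. apply (continuous_comp (U := R_UniformSpace) (V := R_UniformSpace)). Qed.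

Lemma continuous_of_ex_derive (f : R -> R) x : ex_derive f x -> continuous f x.
Proof. apply (ex_derive_continuous (V := R_NormedModule)). Qed.

Lemma ex_RInt_continuous_all (f : R -> R) a b :
  (forall x, continuous f x) -> ex_RInt f a b.
Proof. intros H; apply (ex_RInt_continuous (V := R_CompleteNormedModule)); auto. Qed.

(** [C * atan] is a primitive of the majorant. *)
Lemma Rabs_RInt_atan_le (f : R -> R) C a b :
  (forall x, continuous f x) -> (forall x, Rabs (f x) <= C / (1 + x ^ 2)) ->
  a <= b -> Rabs (RInt f a b) <= C * (atan b - atan a).
Proof.
  intros Hc Hb Hab.
  assert (HI : is_RInt (fun x => C / (1 + x ^ 2)) a b (C * atan b - C * atan a)).
  { apply (is_RInt_derive (V := R_CompleteNormedModule) (fun x => C * atan x)).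
    - intros x _.
      evar_last; [apply is_derive_scal, is_derive_atan|].
      unfold Rsqr; simpl; field; nra.
    - intros x _; apply continuous_of_ex_derive.
      auto_derive; nra. }
  replace (C * (atan b - atan a)) with (C * atan b - C * atan a) by ring.
  apply (norm_RInt_le (V := R_NormedModule) f (fun x => C / (1 + x ^ 2)) a b); auto.
  apply (RInt_correct (V := R_CompleteNormedModule)), ex_RInt_continuous_all, Hc.
Qed.

(** The parts outside [-V,V] are controlled by the arctangent, so the truncated integrals are
    Cauchy. The error bound depends on [f] only through [C], which later lets one cut-off [V] serve
    every [rho]. *)
Lemma improper_integral_inv_sqr (f : R -> R) C :
  (forall x, continuous f x) -> (forall x, Rabs (f x) <= C / (1 + x ^ 2)) ->
  exists I, is_RInt_gen f (Rbar_locally m_infty) (Rbar_locally p_infty) I /\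
    forall V, 0 <= V -> Rabs (I - RInt f (- V) V) <= 2 * C * (PI / 2 - atan V).
Proof.
  intros Hc Hb.
  assert (HC : 0 <= C).
  { generalize (Hb 0) (Rabs_pos (f 0)); unfold Rdiv.
    replace (1 + 0 ^ 2) with 1 by ring; rewrite Rinv_1; lra. }
  assert (Hex : forall a b, ex_RInt f a b) by (intros; now apply ex_RInt_continuous_all).
  assert (Ch : forall a b c, RInt f a b + RInt f b c = RInt f a c).
  { intros a b c; apply (RInt_Chasles (V := R_CompleteNormedModule)); auto. }
  assert (Tail : forall a b V, 0 <= V -> a <= - V -> V <= b ->
    Rabs (RInt f a b - RInt f (- V) V) <= 2 * C * (PI / 2 - atan V)).
  { intros a b V HV Ha HbV.
    rewrite <- (Ch a (- V) b), <- (Ch (- V) V b).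
    replace (_ - _) with (RInt f a (- V) + RInt f V b) by ring.
    generalize (Rabs_RInt_atan_le f C a (- V) Hc Hb Ha)
      (Rabs_RInt_atan_le f C V b Hc Hb HbV)
      (Rabs_triang (RInt f a (- V)) (RInt f V b)) (atan_bound a) (atan_bound b).
    rewrite atan_opp; intros; nra. }
  assert (Far : forall eps, 0 < eps ->
    exists V, 0 <= V /\ 2 * C * (PI / 2 - atan V) < eps).
  { intros eps He.
    (* The [+ 1] avoids a division by zero when [C = 0]; the cap [PI / 4] keeps [PI / 2 - eta] in
       the range where [tan] is positive and inverted by [atan]. *)
    set (eta := Rmin (eps / (2 * C + 1)) (PI / 4)).
    assert (He' : 0 < eps / (2 * C + 1)) by (apply Rdiv_lt_0_compat; lra).
    assert (HP := PI_RGT_0).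
    assert (Heta : 0 < eta) by (apply Rmin_pos; lra).
    assert (Heta1 : eta <= PI / 4) by apply Rmin_r.
    assert (Heta2 : eta <= eps / (2 * C + 1)) by apply Rmin_l.
    exists (tan (PI / 2 - eta)); split.
    - apply Rlt_le, tan_gt_0; lra.
    - rewrite atan_tan by lra.
      replace (PI / 2 - _) with eta by ring.
      apply Rle_lt_trans with (2 * C * (eps / (2 * C + 1))).
      + apply Rmult_le_compat_l; lra.
      + apply Rmult_lt_reg_r with (2 * C + 1); [lra|].
        replace (2 * C * (eps / (2 * C + 1)) * (2 * C + 1)) with (2 * C * eps)
          by (field; lra).
        nra. }
  assert (Lim : exists I, filterlim (fun ab => RInt f (fst ab) (snd ab))
    (filter_prod (Rbar_locally m_infty) (Rbar_locally p_infty)) (locally (I : R))).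
  { apply (filterlim_locally_cauchy (U := R_CompleteSpace)).
    intros eps.
    destruct (Far (eps / 2)) as [V [HV HVe]]; [destruct eps; simpl; lra|].
    exists (fun ab => fst ab <= - V /\ V <= snd ab); split.
    - exists (fun a => a <= - V) (fun b => V <= b); try (intros; now split).
      + exists (- V); intros; lra.
      + exists V; intros; lra.
    - intros [a b] [a' b'] [H1 H2] [H3 H4]; simpl in *.
      generalize (Tail a b V HV H1 H2) (Tail a' b' V HV H3 H4); intros T1 T2.
      change (Rabs (RInt f a' b' - RInt f a b) < eps).
      apply Rabs_def1; apply Rabs_le_between in T1; apply Rabs_le_between in T2; lra. }
  destruct Lim as [I HI]; exists I; split.
  - intros P HP; generalize (HI P HP); unfold filtermap, filtermapi.
    apply filter_imp; intros [a b] H; simpl in *.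
    exists (RInt f a b); split; [|easy].
    apply (RInt_correct (V := R_CompleteNormedModule)), Hex.
  - intros V HV.
    apply le_epsilon; intros eps He.
    (* The tail bound passes to the limit: some end points beyond [V] already give an integral
       within [eps] of [I]. *)
    assert (HF : filter_prod (Rbar_locally m_infty) (Rbar_locally p_infty)
      (fun ab => (fst ab <= - V /\ V <= snd ab) /\
        ball I eps (RInt f (fst ab) (snd ab)))).
    { apply filter_and.
      - exists (fun a => a <= - V) (fun b => V <= b); try (intros; now split).
        + exists (- V); intros; lra.
        + exists V; intros; lra.
      - exact (HI _ (locally_ball I (mkposreal eps He))). }
    apply filter_ex in HF; destruct HF as [[a b] [[H1 H2] H3]]; simpl in *.
    generalize (Tail a b V HV H1 H2); intros T.
    change (Rabs (RInt f a b - I) < eps) in H3.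
    apply Rabs_def2 in H3; apply Rabs_le_between in T; apply Rabs_le_between; lra.
Qed.

Lemma is_RInt_gen_support {W : NormedModule R_AbsRing} (f : R -> W) A B l :
  A <= B -> (forall t, t < A \/ B < t -> f t = zero) -> is_RInt f A B l ->
  is_RInt_gen f (Rbar_locally m_infty) (Rbar_locally p_infty) l.
Proof.
  intros HAB H0 HI P HP.
  exists (fun a => a < A) (fun b => B < b).
  - exists A; auto.
  - exists B; auto.
  - intros a b Ha Hb; simpl; exists l; split; [|now apply locally_singleton].
    assert (Z : forall u v, u < v -> (v <= A \/ B <= u) -> is_RInt f u v zero).
    { intros u v Huv Hout.
      apply is_RInt_ext with (fun _ => (zero : W)).
      - rewrite Rmin_left, Rmax_right by lra.
        intros t Ht; rewrite H0; [easy|lra].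
      - exact (eq_rect _ (is_RInt (fun _ => zero) u v)
          (is_RInt_const u v (zero : W)) _ (scal_zero_r (V := W) (v - u))). }
    replace l with (plus (plus zero l) zero)
      by (now rewrite plus_zero_r, plus_zero_l).
    apply is_RInt_Chasles with B; [apply is_RInt_Chasles with A|];
      [apply Z; [|left; lra]|easy|apply Z; [|right; lra]]; easy.
Qed.

Lemma is_RInt_gen_comp_scale {W : NormedModule R_AbsRing} (f : R -> W) k l :
  0 < k ->
  is_RInt_gen f (Rbar_locally m_infty) (Rbar_locally p_infty) l ->
  is_RInt_gen (fun x => scal k (f (k * x)))
    (Rbar_locally m_infty) (Rbar_locally p_infty) l.
Proof.
  intros Hk H P HP.
  destruct (H P HP) as [Qa Qb [A HA] [B HB] HQ].
  exists (fun a => a < A / k) (fun b => B / k < b).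
  - now exists (A / k).
  - now exists (B / k).
  - intros a b Ha Hb.
    destruct (HQ (k * a) (k * b)) as [y [Hy Py]].
    + apply HA; apply Rmult_lt_compat_l with (r := k) in Ha; [|easy].
      replace (k * (A / k)) with A in Ha by (field; lra); easy.
    + apply HB; apply Rmult_lt_compat_l with (r := k) in Hb; [|easy].
      replace (k * (B / k)) with B in Hb by (field; lra); easy.
    + exists y; split; [|easy]; simpl in *.
      apply is_RInt_ext with (fun x => scal k (f (k * x + 0))).
      * intros; now rewrite Rplus_0_r.
      * apply is_RInt_comp_lin; now rewrite !Rplus_0_r.
Qed.

Lemma is_RInt_gen_pair (f : R -> C) (Fa Fb : (R -> Prop) -> Prop) (la lb : R) :
  Filter Fa -> Filter Fb ->
  is_RInt_gen (fun t => fst (f t)) Fa Fb la ->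
  is_RInt_gen (fun t => snd (f t)) Fa Fb lb ->
  is_RInt_gen (V := C_R_NormedModule) f Fa Fb (la, lb).
Proof.
  intros FFa FFb Ha Hb P [eps HP].
  generalize (Ha _ (locally_ball la eps)) (Hb _ (locally_ball lb eps)).
  unfold filtermapi; intros Ga Gb.
  generalize (filter_and _ _ Ga Gb); apply filter_imp.
  intros ab [[y [Hy By]] [z [Hz Bz]]].
  exists (y, z); split.
  - apply (is_RInt_fct_extend_pair (U := R_NormedModule) (V := R_NormedModule)); easy.
  - apply HP; now split.
Qed.

Section Oscillation.

Variables (f f1 f2 : R -> R) (a b B : R).
Hypothesis Hab : a <= b.
Hypothesis Df : forall x, is_derive f x (f1 x).
Hypothesis Df1 : forall x, is_derive f1 x (f2 x).
Hypothesis Cf2 : forall x, continuous f2 x.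
Hypothesis Ends : f a = 0 /\ f b = 0 /\ f1 a = 0 /\ f1 b = 0.
Hypothesis Bf2 : forall x, a <= x <= b -> Rabs (f2 x) <= B.

(** Two integrations by parts at once, through the derivative of
    [f'(x) g(v x) - v f(x) g'(v x)] when [g'' = -g]. *)
Lemma oscillatory_integral_bound (g g' : R -> R) v :
  (forall x, is_derive g x (g' x)) -> (forall x, is_derive g' x (- g x)) ->
  (forall x, Rabs (g x) <= 1) ->
  v ^ 2 * Rabs (RInt (fun x => f x * g (v * x)) a b) <= (b - a) * B.
Proof.
  intros Dg Dg' Bg.
  assert (Cf : forall x, continuous f x).
  { intros x; apply continuous_of_ex_derive; now exists (f1 x). }
  assert (Cg : forall x, continuous (fun x => g (v * x)) x).
  { intros x; apply (continuous_comp_real (fun x => v * x) g);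
    apply continuous_of_ex_derive;
      [auto_derive; easy|now exists (g' (v * x))]. }
  assert (Cfg : forall x, continuous (fun x => f x * g (v * x)) x)
    by (intros x; apply (continuous_mult f); auto).
  assert (Cf2g : forall x, continuous (fun x => f2 x * g (v * x)) x)
    by (intros x; apply (continuous_mult f2); auto).
  assert (Dv : forall h h' : R -> R, (forall x, is_derive h x (h' x)) ->
    forall x, is_derive (fun x => h (v * x)) x (v * h' (v * x))).
  { intros h h' Dh x.
    apply (is_derive_comp h (fun x => v * x)); [apply Dh|].
    auto_derive; [easy|ring]. }
  set (P x := f1 x * g (v * x) - f x * (v * g' (v * x))).
  assert (HP : is_RInt (fun x => v ^ 2 * (f x * g (v * x)) + f2 x * g (v * x)) a b
                 (minus (P b) (P a))).
  { apply (is_RInt_derive (V := R_CompleteNormedModule)).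
    - intros x _; unfold P.
      evar_last.
      + apply (is_derive_minus (V := R_NormedModule)).
        * apply (is_derive_mult f1); [apply Df1|apply (Dv g g' Dg)|apply Rmult_comm].
        * apply (is_derive_mult f); [apply Df| |apply Rmult_comm].
          apply is_derive_scal, (Dv g' (fun x => - g x) Dg').
      + unfold minus, plus, opp, mult; simpl; ring.
    - intros x _; apply (continuous_plus (V := R_NormedModule)); [|apply Cf2g].
      apply (continuous_scal_r (V := R_NormedModule) (v ^ 2)); apply Cfg. }
  (* Every boundary term has a factor [f] or [f1], both zero at the two ends. Hence [v^2] times the
     integral of [f g] is minus the integral of [f2 g]. *)
  assert (Z : minus (P b) (P a) = 0).
  { destruct Ends as [E1 [E2 [E3 E4]]]; unfold P, minus, plus, opp; simpl.
    rewrite E1, E2, E3, E4; ring. }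
  rewrite Z in HP.
  assert (HS := is_RInt_plus (V := R_NormedModule) _ _ _ _ _ _
    (is_RInt_scal (V := R_NormedModule) _ _ _ (v ^ 2) _
      (RInt_correct (V := R_CompleteNormedModule) _ _ _
        (ex_RInt_continuous_all _ a b Cfg)))
    (RInt_correct (V := R_CompleteNormedModule) _ _ _
      (ex_RInt_continuous_all _ a b Cf2g))).
  apply (is_RInt_unique (V := R_CompleteNormedModule)) in HP.
  apply (is_RInt_unique (V := R_CompleteNormedModule)) in HS.
  assert (E : v ^ 2 * RInt (fun x => f x * g (v * x)) a b
              + RInt (fun x => f2 x * g (v * x)) a b = 0)
    by exact (eq_trans (eq_sym HS) HP).
  replace (v ^ 2) with (Rabs (v ^ 2)) by (apply Rabs_pos_eq; nra).
  rewrite <- Rabs_mult.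
  replace (v ^ 2 * RInt (fun x => f x * g (v * x)) a b)
    with (- RInt (fun x => f2 x * g (v * x)) a b) by lra.
  rewrite Rabs_Ropp.
  apply abs_RInt_le_const; [easy|now apply ex_RInt_continuous_all|].
  intros x Hx; rewrite Rabs_mult.
  generalize (Bf2 x Hx) (Bg (v * x)) (Rabs_pos (f2 x)) (Rabs_pos (g (v * x))).
  intros; nra.
Qed.

End Oscillation.

(** * The symbol in real coordinates *)

(** [root_re z] is the real part of [q = sqrt (1 - i z)], and [damp_re z],
    [damp_im z] are the two components of [1 / (q (q + 1))]. *)
Definition root_re (z : R) : R := sqrt ((sqrt (1 + z ^ 2) + 1) / 2).

(** The squared modulus of [q (q + 1) = (1 - i z) + q], where the imaginary part of [q] is
    [- z / (2 root_re z)]. *)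
Definition damp_den (z : R) : R :=
  (1 + root_re z) ^ 2 + (z + z / (2 * root_re z)) ^ 2.

Definition damp_re (z : R) : R := (1 + root_re z) / damp_den z.

Definition damp_im (z : R) : R := (z + z / (2 * root_re z)) / damp_den z.

Lemma sqrt_one_plus_sqr z : 1 <= sqrt (1 + z ^ 2) <= 1 + z ^ 2 / 2.
Proof.
  split.
  - rewrite <- sqrt_1 at 1; apply sqrt_le_1_alt; nra.
  - rewrite <- (sqrt_pow2 (1 + z ^ 2 / 2)) by nra.
    apply sqrt_le_1_alt; nra.
Qed.

Lemma root_re_sqr z : root_re z ^ 2 = (sqrt (1 + z ^ 2) + 1) / 2.
Proof. apply pow2_sqrt; generalize (sqrt_one_plus_sqr z); lra. Qed.

Lemma root_re_ge_1 z : 1 <= root_re z.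
Proof.
  unfold root_re; rewrite <- sqrt_1 at 1; apply sqrt_le_1_alt.
  generalize (sqrt_one_plus_sqr z); lra.
Qed.

Lemma damp_den_ge_4 z : 4 <= damp_den z.
Proof.
  unfold damp_den.
  generalize (root_re_ge_1 z) (pow2_ge_0 (z + z / (2 * root_re z))); nra.
Qed.

Lemma Csqrt_pr_one_minus z :
  Csqrt_pr (1 - Ci * RtoC z)%C = (root_re z, - (z / (2 * root_re z))).
Proof.
  assert (Hp := root_re_ge_1 z).
  assert (Hm := sqrt_one_plus_sqr z).
  assert (E : (1 - Ci * RtoC z)%C = (1, - z)).
  { unfold Cminus, Cplus, Copp, Cmult, Ci, RtoC; simpl; f_equal; ring. }
  rewrite E; unfold Csqrt_pr, Cmod; simpl fst; simpl snd.
  unfold Re, Im; simpl fst; simpl snd.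
  replace (1 ^ 2 + (- z) ^ 2) with (1 + z ^ 2) by ring.
  (* With [m = sqrt (1 + z^2)], the identity [(m - 1) (m + 1) = z^2] turns [(m - 1) / 2] into
     [z^2 / (4 p^2)] for [p = root_re z]. The sign test in [Csqrt_pr] then removes the absolute
     value. *)
  assert (S : sqrt ((sqrt (1 + z ^ 2) - 1) / 2) = Rabs z / (2 * root_re z)).
  { rewrite <- (sqrt_pow2 (Rabs z / (2 * root_re z))).
    - f_equal.
      unfold Rdiv; rewrite Rpow_mult_distr, pow2_abs, pow_inv, Rpow_mult_distr,
        root_re_sqr.
      assert (H : sqrt (1 + z ^ 2) ^ 2 = 1 + z ^ 2) by (apply pow2_sqrt; nra).
      replace (z ^ 2) with (sqrt (1 + z ^ 2) ^ 2 - 1) at 2 by lra.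
      field; lra.
    - apply Rdiv_le_0_compat; [apply Rabs_pos|lra]. }
  rewrite S; f_equal.
  destruct (Rlt_dec (- z) 0) as [H|H].
  - now rewrite Rabs_pos_eq by lra.
  - rewrite Rabs_left1 by lra; field; lra.
Qed.

(** With [q^2 = 1 - i tau0 w], the coefficient is [i w (q - 1) / (c0 q) = i w (q^2 - 1) / (c0 q (q +
    1)) = tau0 w^2 / (c0 q (q + 1))]. This resolves the cancellation at low frequency and exposes
    the factor [w^2] behind the Gaussian limit. *)
Lemma alpha_tv_eq c0 tau0 w : 0 < c0 ->
  alpha_tv c0 tau0 w =
  (tau0 * w ^ 2 / c0 * damp_re (tau0 * w), tau0 * w ^ 2 / c0 * damp_im (tau0 * w)).
Proof.
  intros Hc.
  assert (Hp := root_re_ge_1 (tau0 * w)).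
  assert (HD := damp_den_ge_4 (tau0 * w)).
  (* The real part of [q^2] is [1]; after multiplication by [root_re^2] this becomes a polynomial
     identity in [sqrt (1 + z^2)]. *)
  assert (Hz : root_re (tau0 * w) ^ 2
      - (tau0 * w / (2 * root_re (tau0 * w))) ^ 2 = 1).
  { assert (H : (root_re (tau0 * w) ^ 2) ^ 2 - (tau0 * w) ^ 2 / 4
      = root_re (tau0 * w) ^ 2).
    { rewrite root_re_sqr.
      assert (H : sqrt (1 + (tau0 * w) ^ 2) ^ 2 = 1 + (tau0 * w) ^ 2)
        by (apply pow2_sqrt; nra).
      nra. }
    apply Rmult_eq_reg_l with (root_re (tau0 * w) ^ 2); [|nra].
    rewrite Rmult_1_r; etransitivity; [|exact H]; field; lra. }
  unfold alpha_tv; rewrite Csqrt_pr_one_minus.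
  set (z := tau0 * w) in *; set (p := root_re z) in *.
  set (q := (p, - (z / (2 * p))) : C).
  assert (Hq : (q * q = 1 - Ci * RtoC z)%C).
  { unfold q, Cminus, Cplus, Copp, Cmult, Ci, RtoC; simpl; f_equal.
    - rewrite Rmult_0_l in *; nra.
    - field; lra. }
  assert (Hc' : RtoC c0 <> 0%C) by (intros H; apply RtoC_inj in H; lra).
  assert (Hq0 : q <> 0%C) by (intros H; apply (f_equal fst) in H; simpl in H; lra).
  assert (Hq1 : (q + 1)%C <> 0%C)
    by (intros H; apply (f_equal fst) in H; simpl in H; lra).
  transitivity (RtoC (tau0 * w ^ 2 / c0) / (q * q + q))%C.
  - assert (HI : (Ci * Ci = - (1))%C)
      by (unfold Cmult, Copp, Ci, RtoC; simpl; f_equal; ring).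
    assert (K : (Ci * RtoC w * (q * q - 1) = RtoC (tau0 * w ^ 2))%C).
    { rewrite Hq.
      replace (Ci * RtoC w * (1 - Ci * RtoC z - 1))%C
        with (- (Ci * Ci) * (RtoC w * RtoC z))%C by ring.
      rewrite HI; unfold z; rewrite <- !RtoC_mult.
      replace (tau0 * w ^ 2) with (w * (tau0 * w)) by ring; ring. }
    unfold Rdiv at 1; rewrite RtoC_mult, RtoC_inv, <- K by lra.
    field; repeat split; auto.
    replace (q * q + q)%C with (q * (q + 1))%C by ring.
    now apply Cmult_neq_0.
  - rewrite Hq; unfold damp_re, damp_im, damp_den; fold p.
    unfold damp_den in HD; fold p in HD.
    unfold q, Cdiv, Cinv, Cminus, Cplus, Copp, Cmult, Ci, RtoC; simpl.
    replace (1 + - (0 * z - 1 * 0) + p) with (1 + p) by ring.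
    replace (0 + - (0 * 0 + 1 * z) + - (z / (2 * p)))
      with (- (z + z / (2 * p))) by ring.
    set (y := z + z / (2 * p)) in *.
    f_equal; field; repeat split; try lra; nra.
Qed.

Lemma symbol_eq c0 tau0 x w : 0 < c0 ->
  let k := norm3 x * tau0 * w ^ 2 / c0 in
  let z := tau0 * w in
  symbol c0 tau0 x w =
  (exp (- (k * damp_re z)) * cos (k * damp_im z),
   - (exp (- (k * damp_re z)) * sin (k * damp_im z))).
Proof.
  intros Hc k z; unfold symbol; rewrite alpha_tv_eq by easy; fold z.
  unfold Cexp, Re, Im, Copp, Cmult, RtoC; simpl fst; simpl snd.
  replace (- (_ - _)) with (- (k * damp_re z)) by (unfold k; field; lra).
  replace (- (_ + _)) with (- (k * damp_im z)) by (unfold k; field; lra).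
  rewrite cos_neg, sin_neg; f_equal; ring.
Qed.

Lemma damp_re_nonneg z : 0 <= damp_re z.
Proof.
  generalize (root_re_ge_1 z) (damp_den_ge_4 z); intros.
  apply Rdiv_le_0_compat; lra.
Qed.

Lemma Rabs_half_root_le z : Rabs (z + z / (2 * root_re z)) <= 3 / 2 * Rabs z.
Proof.
  assert (Hp := root_re_ge_1 z).
  replace (z + z / (2 * root_re z)) with ((1 + / (2 * root_re z)) * z)
    by (field; lra).
  assert (Hi : 0 < / (2 * root_re z) <= / 2).
  { split; [apply Rinv_0_lt_compat|apply Rinv_le_contravar]; lra. }
  rewrite Rabs_mult; apply Rmult_le_compat_r; [apply Rabs_pos|].
  rewrite Rabs_pos_eq; lra.
Qed.

Lemma damp_im_le z : Rabs (damp_im z) <= Rabs z.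
Proof.
  assert (HD := damp_den_ge_4 z).
  unfold damp_im, Rdiv at 1; rewrite Rabs_mult, Rabs_inv, (Rabs_pos_eq (damp_den z)) by lra.
  apply Rmult_le_reg_r with (damp_den z); [lra|].
  rewrite Rmult_assoc, Rinv_l, Rmult_1_r by lra.
  generalize (Rabs_half_root_le z) (Rabs_pos z); nra.
Qed.

(** At [z = 0] the root is [1] and [1 / (q (q + 1))] is [1 / 2]. Together with [damp_im_le] this is
    the quantitative form of the convergence of the symbol. *)
Lemma damp_re_half_le z : Rabs (damp_re z - 1 / 2) <= z ^ 2.
Proof.
  assert (Hp := root_re_ge_1 z).
  assert (HD := damp_den_ge_4 z).
  assert (Hs := root_re_sqr z).
  assert (Hm := sqrt_one_plus_sqr z).
  assert (Hy : (z + z / (2 * root_re z)) ^ 2 <= 9 / 4 * z ^ 2).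
  { rewrite <- pow2_abs, <- (pow2_abs z).
    generalize (Rabs_half_root_le z) (Rabs_pos (z + z / (2 * root_re z))); nra. }
  replace (damp_re z - 1 / 2) with ((2 * (1 + root_re z) - damp_den z) / (2 * damp_den z))
    by (unfold damp_re; field; lra).
  unfold Rdiv; rewrite Rabs_mult, Rabs_inv, (Rabs_pos_eq (2 * damp_den z)) by lra.
  apply Rmult_le_reg_r with (2 * damp_den z); [lra|].
  rewrite Rmult_assoc, Rinv_l, Rmult_1_r by lra.
  (* The numerator is [(1 - p^2) - y^2] with [p = root_re z] and [y = z + z / (2 p)]. Here
     [p^2 - 1 <= z^2 / 4] and [y^2 <= 9 z^2 / 4], while the denominator is at least [8]. *)
  apply Rle_trans with (z ^ 2 * 8); [|apply Rmult_le_compat_l; nra].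
  unfold damp_den; apply Rabs_le; split; nra.
Qed.

Lemma continuous_damp_re z : continuous damp_re z.
Proof.
  assert (Hp := root_re_ge_1 z).
  assert (HD := damp_den_ge_4 z).
  assert (Hm := sqrt_one_plus_sqr z).
  apply continuous_of_ex_derive.
  unfold damp_re, damp_den, root_re in *; auto_derive.
  repeat split; try nra; simpl in *; try lra.
Qed.

Lemma continuous_damp_im z : continuous damp_im z.
Proof.
  assert (Hp := root_re_ge_1 z).
  assert (HD := damp_den_ge_4 z).
  assert (Hm := sqrt_one_plus_sqr z).
  apply continuous_of_ex_derive.
  unfold damp_im, damp_den, root_re in *; auto_derive.
  repeat split; try nra; simpl in *; try lra.
Qed.

(** * Transform of the bump and the Gaussian limit *)

Lemma lipschitz_of_derive (g g' : R -> R) :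
  (forall x, is_derive g x (g' x)) -> (forall x, Rabs (g' x) <= 1) ->
  forall x y, Rabs (g y - g x) <= Rabs (y - x).
Proof.
  intros Dg Bg x y.
  destruct (MVT_gen g x y g') as [c [_ ->]].
  - auto.
  - intros z _; apply derivable_continuous_pt; exists (g' z); now apply is_derive_Reals.
  - rewrite Rabs_mult; generalize (Bg c) (Rabs_pos (y - x)); nra.
Qed.

Lemma is_derive_opp_sin x : is_derive (fun x => - sin x) x (- cos x).
Proof. auto_derive; [easy|ring]. Qed.

Lemma Rabs_cos_le x : Rabs (cos x) <= 1.
Proof. apply Rabs_le, COS_bound. Qed.

Lemma Rabs_sin_le x : Rabs (sin x) <= 1.
Proof. apply Rabs_le, SIN_bound. Qed.

Lemma Rabs_cos_sub_le x y : Rabs (cos y - cos x) <= Rabs (y - x).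
Proof.
  apply (lipschitz_of_derive cos (fun x => - sin x)); [apply is_derive_cos|].
  intros z; rewrite Rabs_Ropp; apply Rabs_sin_le.
Qed.

Lemma Rabs_sin_sub_le x y : Rabs (sin y - sin x) <= Rabs (y - x).
Proof. apply (lipschitz_of_derive sin cos); [apply is_derive_sin|apply Rabs_cos_le]. Qed.

Lemma exp_le_compat x y : x <= y -> exp x <= exp y.
Proof.
  intros [H| ->]; [now apply Rlt_le, exp_increasing|apply Rle_refl].
Qed.

(** The derivative is bounded by [1] only on the half-line, so [lipschitz_of_derive] does not apply.
    Factoring out [exp (-u)] reduces the claim to [1 - s <= exp (-s)]. *)
Lemma Rabs_exp_neg_sub_le x y :
  0 <= x -> 0 <= y -> Rabs (exp (- y) - exp (- x)) <= Rabs (y - x).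
Proof.
  assert (K : forall u v, 0 <= u -> u <= v -> exp (- u) - exp (- v) <= v - u).
  { intros u v Hu Huv.
    replace (- v) with (- u + (- (v - u))) by ring.
    rewrite exp_plus.
    assert (H1 : exp (- u) <= 1) by (rewrite <- exp_0; apply exp_le_compat; lra).
    generalize (exp_ineq1_le (- (v - u))) (exp_pos (- u)); nra. }
  assert (Mo : forall u v, u <= v -> exp (- v) <= exp (- u))
    by (intros; apply exp_le_compat; lra).
  intros Hx Hy; destruct (Rle_dec x y) as [H|H].
  - rewrite (Rabs_left1 (_ - _)), (Rabs_pos_eq (y - x)); try lra.
    + generalize (K x y); lra.
    + generalize (Mo x y); lra.
  - rewrite (Rabs_pos_eq (_ - _)), (Rabs_left1 (y - x)); try lra.
    + generalize (K y x); lra.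
    + generalize (Mo y x); lra.
Qed.

(** From [cos x = 1 - 2 sin^2 (x / 2)] and [|sin y| <= |y|]. *)
Lemma one_minus_half_sqr_le_cos x : 1 - x ^ 2 / 2 <= cos x.
Proof.
  replace x with (2 * (x / 2)) at 2 by field.
  rewrite cos_2a_sin.
  generalize (Rabs_sin_sub_le 0 (x / 2)); rewrite sin_0, !Rminus_0_r; intros H.
  generalize (pow2_abs (sin (x / 2))) (pow2_abs (x / 2)) (Rabs_pos (sin (x / 2))).
  intros; nra.
Qed.

Lemma continuous_bump t : continuous bump t.
Proof.
  apply continuous_of_ex_derive.
  apply smooth_upto_ex_derive with O, smooth_upto_bump.
Qed.

Definition bump_mass : R := RInt bump (- 2) (- 1).

Lemma bump_mass_pos : 0 < bump_mass.
Proof.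
  apply RInt_gt_0; [lra|apply bump_pos|].
  intros; apply continuous_bump.
Qed.

(** For [g = cos] and [g = sin] these are the real part and minus the imaginary part of the integral
    of [bump u] against [exp (-i v u)]. Keeping [g] abstract treats both at once. *)
Definition bump_transform (g : R -> R) (v : R) : R :=
  RInt (fun u => bump u * g (v * u)) (- 2) (- 1).

Section Transform.

Variables g g' : R -> R.
Hypothesis Dg : forall x, is_derive g x (g' x).
Hypothesis Bg : forall x, Rabs (g x) <= 1.

Lemma continuous_bump_osc v t : continuous (fun u => bump u * g (v * u)) t.
Proof.
  apply (continuous_mult bump (fun u => g (v * u))); [apply continuous_bump|].
  apply (continuous_comp_real (fun x => v * x) g);
  apply continuous_of_ex_derive;
    [auto_derive; easy|now exists (g' (v * t))].
Qed.

Lemma is_RInt_bump_transform v :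
  is_RInt (fun u => bump u * g (v * u)) (- 2) (- 1) (bump_transform g v).
Proof.
  apply (RInt_correct (V := R_CompleteNormedModule)), ex_RInt_continuous_all.
  apply continuous_bump_osc.
Qed.

Lemma is_RInt_bump_scal k : is_RInt (fun u => k * bump u) (- 2) (- 1) (k * bump_mass).
Proof.
  apply (is_RInt_scal (V := R_NormedModule) bump).
  apply (RInt_correct (V := R_CompleteNormedModule)), ex_RInt_continuous_all.
  apply continuous_bump.
Qed.

Lemma bump_transform_le_mass v : Rabs (bump_transform g v) <= bump_mass.
Proof.
  rewrite <- (Rmult_1_l bump_mass).
  apply (norm_RInt_le (V := R_NormedModule) (fun u => bump u * g (v * u))
    (fun u => 1 * bump u) (- 2) (- 1)); [lra| |apply is_RInt_bump_transform|
    apply is_RInt_bump_scal].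
  intros u _; change (Rabs (bump u * g (v * u)) <= 1 * bump u).
  rewrite Rabs_mult, (Rabs_pos_eq (bump u)) by apply bump_nonneg.
  generalize (bump_nonneg u) (Bg (v * u)); nra.
Qed.

(** The factor [2] bounds [|u|] on the support of [bump]. *)
Lemma bump_transform_lipschitz v w :
  (forall x y, Rabs (g y - g x) <= Rabs (y - x)) ->
  Rabs (bump_transform g w - bump_transform g v) <= 2 * bump_mass * Rabs (w - v).
Proof.
  intros Lg.
  replace (2 * bump_mass * Rabs (w - v)) with (2 * Rabs (w - v) * bump_mass) by ring.
  apply (norm_RInt_le (V := R_NormedModule)
    (fun u => minus (bump u * g (w * u)) (bump u * g (v * u)))
    (fun u => 2 * Rabs (w - v) * bump u) (- 2) (- 1)); [lra| | |apply is_RInt_bump_scal].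
  - intros u Hu; change (Rabs (bump u * g (w * u) - bump u * g (v * u))
      <= 2 * Rabs (w - v) * bump u).
    rewrite <- Rmult_minus_distr_l, Rabs_mult, (Rabs_pos_eq (bump u))
      by apply bump_nonneg.
    rewrite (Rmult_comm _ (bump u)).
    apply Rmult_le_compat_l; [apply bump_nonneg|].
    eapply Rle_trans; [apply Lg|].
    rewrite <- Rmult_minus_distr_r, Rabs_mult, (Rabs_left1 u) by lra.
    generalize (Rabs_pos (w - v)); nra.
  - apply (is_RInt_minus (V := R_NormedModule)); apply is_RInt_bump_transform.
Qed.

Lemma continuous_bump_transform v :
  (forall x y, Rabs (g y - g x) <= Rabs (y - x)) -> continuous (bump_transform g) v.
Proof.
  intros Lg.
  assert (HM := bump_mass_pos).
  apply (filterlim_locally (U := R_UniformSpace)); intros eps.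
  assert (Hd : 0 < eps / (2 * bump_mass))
    by (apply Rdiv_lt_0_compat; destruct eps; simpl; lra).
  exists (mkposreal _ Hd); intros w Hw.
  change (Rabs (w - v) < eps / (2 * bump_mass)) in Hw.
  change (Rabs (bump_transform g w - bump_transform g v) < eps).
  eapply Rle_lt_trans; [now apply bump_transform_lipschitz|].
  apply (Rmult_lt_compat_l (2 * bump_mass)) in Hw; [|lra].
  replace (2 * bump_mass * (eps / (2 * bump_mass))) with (eps : R) in Hw
    by (field; lra); easy.
Qed.

End Transform.

(** [bump] is nonnegative, so each of its zeros is a minimum. This supplies the vanishing end values
    for the integration by parts. *)
Lemma is_derive_bump_zero f' t :
  (forall x, is_derive bump x (f' x)) -> bump t = 0 -> f' t = 0.
Proof.
  intros D H.
  assert (Dt : derivable_pt_lim bump t (f' t)) by (apply is_derive_Reals; auto).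
  rewrite <- (derive_pt_eq_0 bump t (f' t) (exist _ _ Dt) Dt).
  apply deriv_minimum with (t - 1) (t + 1); try lra.
  intros x _ _; rewrite H; apply bump_nonneg.
Qed.

(** The bound by the mass and the bound on [v^2] times the transform add up to one on [1 + v^2]
    times it. *)
Lemma bump_transform_decay : exists B, 0 <= B /\
  forall v, Rabs (bump_transform cos v) <= B / (1 + v ^ 2) /\
            Rabs (bump_transform sin v) <= B / (1 + v ^ 2).
Proof.
  (* The third derivative serves to make [f2] continuous, hence bounded on [-2,-1]. *)
  destruct (smooth_upto_bump 3) as [f1 [D1 [f2 [D2 [f3 [D3 _]]]]]].
  assert (C2 : forall x, continuous f2 x).
  { intros x; apply continuous_of_ex_derive; now exists (f3 x). }
  destruct (bounded_continuity f2 (- 2) (- 1)) as [K HK]; [intros; apply C2|].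
  assert (HK' : forall x, - 2 <= x <= - 1 -> Rabs (f2 x) <= K)
    by (intros; now apply Rlt_le, HK).
  assert (HK0 : 0 <= K) by (eapply Rle_trans; [apply Rabs_pos|apply (HK' (- 2)); lra]).
  assert (Ends : bump (- 2) = 0 /\ bump (- 1) = 0 /\ f1 (- 2) = 0 /\ f1 (- 1) = 0).
  { assert (E1 : bump (- 2) = 0) by (apply bump_out; lra).
    assert (E2 : bump (- 1) = 0) by (apply bump_out; lra).
    repeat split; auto; now apply is_derive_bump_zero. }
  assert (HM := bump_mass_pos).
  exists (bump_mass + K); split; [lra|]; intros v.
  assert (Comb : forall y, 0 <= y -> y <= bump_mass -> v ^ 2 * y <= (- 1 - - 2) * K ->
    y <= (bump_mass + K) / (1 + v ^ 2)).
  { intros y H0 H1 H2.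
    apply Rmult_le_reg_r with (1 + v ^ 2); [nra|].
    replace ((bump_mass + K) / (1 + v ^ 2) * (1 + v ^ 2)) with (bump_mass + K)
      by (field; nra).
    nra. }
  split; apply Comb; try apply Rabs_pos.
  - apply (bump_transform_le_mass cos _ is_derive_cos Rabs_cos_le).
  - apply (oscillatory_integral_bound bump f1 f2 (- 2) (- 1) K) with (fun x => - sin x);
      auto; try lra.
    + apply is_derive_cos.
    + apply is_derive_opp_sin.
    + apply Rabs_cos_le.
  - apply (bump_transform_le_mass sin _ is_derive_sin Rabs_sin_le).
  - apply (oscillatory_integral_bound bump f1 f2 (- 2) (- 1) K) with cos; auto; try lra.
    + apply is_derive_sin.
    + apply is_derive_cos.
    + apply Rabs_sin_le.
Qed.

(** On the support [u^2 <= 4], so [cos (v u) >= 1 - v^2 u^2 / 2 >= 1 - 2 v^2]. *)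
Lemma bump_transform_cos_ge v : bump_mass * (1 - 2 * v ^ 2) <= bump_transform cos v.
Proof.
  rewrite Rmult_comm.
  apply (is_RInt_le (fun u => (1 - 2 * v ^ 2) * bump u) (fun u => bump u * cos (v * u))
    (- 2) (- 1)); [lra|apply is_RInt_bump_scal|
    apply (is_RInt_bump_transform cos _ is_derive_cos)|].
  intros u Hu.
  rewrite Rmult_comm; apply Rmult_le_compat_l; [apply bump_nonneg|].
  eapply Rle_trans; [|apply one_minus_half_sqr_le_cos].
  assert (u ^ 2 <= 4) by nra.
  rewrite Rpow_mult_distr; generalize (pow2_ge_0 v); nra.
Qed.

(** [exp (-2 v^2) (1 - 2 v^2)] is [exp (-2 v^2) / 2] plus the derivative of
    [v exp (-2 v^2) / 2]. *)
Lemma gaussian_integral_ge V : 1 <= V ->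
  exp (- 2) <= RInt (fun v => exp (- (2 * v ^ 2)) * (1 - 2 * v ^ 2)) (- V) V.
Proof.
  intros HV.
  set (h := fun v => exp (- (2 * v ^ 2)) / 2).
  assert (Ch : forall v, continuous h v).
  { intros v; apply continuous_of_ex_derive; unfold h; auto_derive; easy. }
  assert (Eh : forall a b, ex_RInt h a b) by (intros; now apply ex_RInt_continuous_all).
  assert (Hpos : forall v, 0 <= h v)
    by (intros v; unfold h; generalize (exp_pos (- (2 * v ^ 2))); lra).
  assert (H1 : is_RInt (fun v => exp (- (2 * v ^ 2)) * (1 / 2 - 2 * v ^ 2)) (- V) V
    (minus (V * exp (- (2 * V ^ 2)) / 2) (- V * exp (- (2 * (- V) ^ 2)) / 2))).
  { apply (is_RInt_derive (V := R_CompleteNormedModule)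
      (fun v => v * exp (- (2 * v ^ 2)) / 2)).
    - intros v _; auto_derive; [easy|simpl; field].
    - intros v _; apply continuous_of_ex_derive; auto_derive; easy. }
  assert (H2 := RInt_correct (V := R_CompleteNormedModule) h (- V) V (Eh _ _)).
  assert (H3 := is_RInt_plus (V := R_NormedModule) _ _ _ _ _ _ H2 H1).
  assert (H4 : exp (- 2) <= RInt h (- V) V).
  { assert (Ch1 : RInt h (- V) (- 1) + RInt h (- 1) V = RInt h (- V) V)
      by (apply (RInt_Chasles (V := R_CompleteNormedModule)); auto).
    assert (Ch2 : RInt h (- 1) 1 + RInt h 1 V = RInt h (- 1) V)
      by (apply (RInt_Chasles (V := R_CompleteNormedModule)); auto).
    assert (P1 : 0 <= RInt h (- V) (- 1)) by (apply RInt_ge_0; auto; lra).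
    assert (P2 : 0 <= RInt h 1 V) by (apply RInt_ge_0; auto; lra).
    (* On [-1,1] the integrand is at least [exp (-2) / 2], and the interval has length [2]. *)
    assert (P3 : exp (- 2) <= RInt h (- 1) 1).
    { replace (exp (- 2)) with (RInt (fun _ => exp (- 2) / 2) (- 1) 1).
      - apply RInt_le; auto; [lra|apply ex_RInt_const|].
        intros v Hv; unfold h.
        assert (exp (- 2) <= exp (- (2 * v ^ 2))) by (apply exp_le_compat; nra); lra.
      - rewrite RInt_const; unfold scal; simpl; unfold mult; simpl; field. }
    lra. }
  rewrite (is_RInt_unique (V := R_CompleteNormedModule) _ (- V) V
    (plus (RInt h (- V) V)
      (minus (V * exp (- (2 * V ^ 2)) / 2) (- V * exp (- (2 * (- V) ^ 2)) / 2)))).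
  - unfold minus, plus, opp; simpl plus.
    replace (2 * (- V) ^ 2) with (2 * V ^ 2) by ring.
    generalize (exp_pos (- (2 * V ^ 2))); simpl; nra.
  - eapply is_RInt_ext; [|exact H3].
    intros v _; unfold h, plus; simpl; field.
Qed.

(** With [w = v / d], [rho = tau0 / d] and [|x| = 4 c0 d^2 / tau0], the symbol at
    [w] is [exp (- (decay_exponent rho v + i phase rho v))]; [pairing_re] and
    [pairing_im] are the components of its product with the transform of [bump]. *)
Definition decay_exponent (rho v : R) : R := 4 * v ^ 2 * damp_re (rho * v).

Definition phase (rho v : R) : R := 4 * v ^ 2 * damp_im (rho * v).

Definition pairing_re (rho v : R) : R :=
  exp (- decay_exponent rho v) *
  (cos (phase rho v) * bump_transform cos v - sin (phase rho v) * bump_transform sin v).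

Definition pairing_im (rho v : R) : R :=
  - (exp (- decay_exponent rho v) *
  (sin (phase rho v) * bump_transform cos v + cos (phase rho v) * bump_transform sin v)).

Lemma decay_exponent_nonneg rho v : 0 <= decay_exponent rho v.
Proof.
  unfold decay_exponent; generalize (damp_re_nonneg (rho * v)) (pow2_ge_0 v); nra.
Qed.

Lemma continuous_quadratic_comp (f : R -> R) rho v :
  (forall z, continuous f z) -> continuous (fun v => 4 * v ^ 2 * f (rho * v)) v.
Proof.
  intros Cf; apply (continuous_mult (fun v => 4 * v ^ 2) (fun v => f (rho * v))).
  - apply continuous_of_ex_derive; auto_derive; easy.
  - apply (continuous_comp_real (fun v => rho * v)); [|apply Cf].
    apply continuous_of_ex_derive; auto_derive; easy.
Qed.

Lemma continuous_exp_decay rho v : continuous (fun v => exp (- decay_exponent rho v)) v.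
Proof.
  apply (continuous_comp_real (decay_exponent rho) (fun y => exp (- y))).
  - apply continuous_quadratic_comp, continuous_damp_re.
  - apply continuous_of_ex_derive; auto_derive; easy.
Qed.

Lemma continuous_phase rho v : continuous (phase rho) v.
Proof. apply continuous_quadratic_comp, continuous_damp_im. Qed.

Lemma continuous_cos_phase rho v : continuous (fun v => cos (phase rho v)) v.
Proof.
  apply (continuous_comp_real (phase rho) cos); [apply continuous_phase|].
  apply continuous_of_ex_derive; auto_derive; easy.
Qed.

Lemma continuous_sin_phase rho v : continuous (fun v => sin (phase rho v)) v.
Proof.
  apply (continuous_comp_real (phase rho) sin); [apply continuous_phase|].
  apply continuous_of_ex_derive; auto_derive; easy.
Qed.

Lemma continuous_bump_transform_cos v : continuous (bump_transform cos) v.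
Proof. apply (continuous_bump_transform cos _ is_derive_cos), Rabs_cos_sub_le. Qed.

Lemma continuous_bump_transform_sin v : continuous (bump_transform sin) v.
Proof. apply (continuous_bump_transform sin _ is_derive_sin), Rabs_sin_sub_le. Qed.

Lemma continuous_pairing_re rho v : continuous (pairing_re rho) v.
Proof.
  apply (continuous_mult (fun v => exp (- decay_exponent rho v))
    (fun v => cos (phase rho v) * bump_transform cos v
      - sin (phase rho v) * bump_transform sin v)); [apply continuous_exp_decay|].
  apply (continuous_minus (V := R_NormedModule)
    (fun v => cos (phase rho v) * bump_transform cos v)
    (fun v => sin (phase rho v) * bump_transform sin v)).
  - apply (continuous_mult (fun v => cos (phase rho v)));
      [apply continuous_cos_phase|apply continuous_bump_transform_cos].
  - apply (continuous_mult (fun v => sin (phase rho v)));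
      [apply continuous_sin_phase|apply continuous_bump_transform_sin].
Qed.

Lemma continuous_pairing_im rho v : continuous (pairing_im rho) v.
Proof.
  apply (continuous_opp (V := R_NormedModule) (fun v => exp (- decay_exponent rho v) *
    (sin (phase rho v) * bump_transform cos v + cos (phase rho v) * bump_transform sin v))).
  apply (continuous_mult (fun v => exp (- decay_exponent rho v))
    (fun v => sin (phase rho v) * bump_transform cos v
      + cos (phase rho v) * bump_transform sin v)); [apply continuous_exp_decay|].
  apply (continuous_plus (V := R_NormedModule)
    (fun v => sin (phase rho v) * bump_transform cos v)
    (fun v => cos (phase rho v) * bump_transform sin v)).
  - apply (continuous_mult (fun v => sin (phase rho v)));
      [apply continuous_sin_phase|apply continuous_bump_transform_cos].
  - apply (continuous_mult (fun v => cos (phase rho v)));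
      [apply continuous_cos_phase|apply continuous_bump_transform_sin].
Qed.

Lemma Rabs_damped_le e a b x y B :
  0 <= e <= 1 -> Rabs a <= 1 -> Rabs b <= 1 -> Rabs x <= B -> Rabs y <= B ->
  Rabs (e * (a * x + b * y)) <= 2 * B.
Proof.
  intros He Ha Hb Hx Hy.
  assert (Rabs (a * x) <= B)
    by (rewrite Rabs_mult; generalize (Rabs_pos a) (Rabs_pos x); nra).
  assert (Rabs (b * y) <= B)
    by (rewrite Rabs_mult; generalize (Rabs_pos b) (Rabs_pos y); nra).
  assert (Hsum : Rabs (a * x + b * y) <= 2 * B)
    by (eapply Rle_trans; [apply Rabs_triang|lra]).
  rewrite Rabs_mult, (Rabs_pos_eq e) by easy.
  generalize (Rabs_pos (a * x + b * y)); nra.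
Qed.

Lemma exp_decay_bounds rho v : 0 <= exp (- decay_exponent rho v) <= 1.
Proof.
  split; [apply Rlt_le, exp_pos|].
  rewrite <- exp_0; apply exp_le_compat.
  generalize (decay_exponent_nonneg rho v); lra.
Qed.

Lemma Rabs_pairing_re_le B rho v :
  Rabs (bump_transform cos v) <= B -> Rabs (bump_transform sin v) <= B ->
  Rabs (pairing_re rho v) <= 2 * B.
Proof.
  intros Hc Hs; unfold pairing_re, Rminus; rewrite Ropp_mult_distr_l.
  apply Rabs_damped_le; auto using exp_decay_bounds, Rabs_cos_le.
  rewrite Rabs_Ropp; apply Rabs_sin_le.
Qed.

Lemma Rabs_pairing_im_le B rho v :
  Rabs (bump_transform cos v) <= B -> Rabs (bump_transform sin v) <= B ->
  Rabs (pairing_im rho v) <= 2 * B.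
Proof.
  intros Hc Hs; unfold pairing_im; rewrite Rabs_Ropp.
  apply Rabs_damped_le; auto using exp_decay_bounds, Rabs_cos_le, Rabs_sin_le.
Qed.

(** For [|v| <= V] the exponent is within [4 V^3 rho] of [2 v^2] and the phase within [4 V^3 rho] of
    [0]; [rho * V <= 1] is what replaces [(rho V)^2] by [rho V]. Each of three errors, in modulus,
    cosine and sine, costs at most this times [bump_mass]. *)
Lemma pairing_re_near_gaussian V rho v :
  0 < rho -> rho * V <= 1 -> 1 <= V -> Rabs v <= V ->
  exp (- (2 * v ^ 2)) * bump_transform cos v - 12 * bump_mass * V ^ 3 * rho
  <= pairing_re rho v.
Proof.
  intros Hr HrV HV Hv.
  assert (HM := bump_mass_pos).
  assert (Ha := Rabs_pos v).
  assert (Hz : Rabs (rho * v) <= rho * V)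
    by (rewrite Rabs_mult, (Rabs_pos_eq rho) by lra; nra).
  assert (Hz0 := Rabs_pos (rho * v)).
  assert (Hv2 : 0 <= v ^ 2 <= V ^ 2) by (rewrite <- (pow2_abs v); nra).
  assert (E3 : V ^ 3 * rho = V ^ 2 * (rho * V)) by ring.
  assert (HX : Rabs (decay_exponent rho v - 2 * v ^ 2) <= 4 * (V ^ 3 * rho)).
  { unfold decay_exponent.
    replace (_ - _) with (4 * v ^ 2 * (damp_re (rho * v) - 1 / 2)) by field.
    rewrite Rabs_mult, Rabs_pos_eq, E3 by lra.
    assert (H : Rabs (damp_re (rho * v) - 1 / 2) <= rho * V).
    { eapply Rle_trans; [apply damp_re_half_le|].
      rewrite <- pow2_abs; nra. }
    generalize (Rabs_pos (damp_re (rho * v) - 1 / 2)); nra. }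
  assert (HY : Rabs (phase rho v) <= 4 * (V ^ 3 * rho)).
  { unfold phase; rewrite Rabs_mult, Rabs_pos_eq, E3 by lra.
    generalize (damp_im_le (rho * v)) (Rabs_pos (damp_im (rho * v))); nra. }
  assert (Hc := bump_transform_le_mass cos _ is_derive_cos Rabs_cos_le v).
  assert (Hs := bump_transform_le_mass sin _ is_derive_sin Rabs_sin_le v).
  assert (He := exp_decay_bounds rho v).
  assert (H1 : Rabs (exp (- decay_exponent rho v) - exp (- (2 * v ^ 2))) <= 4 * (V ^ 3 * rho)).
  { eapply Rle_trans; [apply Rabs_exp_neg_sub_le|exact HX];
      [lra|apply decay_exponent_nonneg]. }
  assert (H2 : Rabs (cos (phase rho v) - 1) <= 4 * (V ^ 3 * rho)).
  { rewrite <- cos_0; eapply Rle_trans; [apply Rabs_cos_sub_le|].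
    now rewrite Rminus_0_r. }
  assert (H3 : Rabs (sin (phase rho v)) <= 4 * (V ^ 3 * rho)).
  { replace (sin (phase rho v)) with (sin (phase rho v) - sin 0)
      by (rewrite sin_0; ring).
    eapply Rle_trans; [apply Rabs_sin_sub_le|]; now rewrite Rminus_0_r. }
  unfold pairing_re.
  set (e := exp (- decay_exponent rho v)) in *.
  set (e0 := exp (- (2 * v ^ 2))) in *.
  set (c := bump_transform cos v) in *; set (s := bump_transform sin v) in *.
  set (C := cos (phase rho v)) in *; set (S := sin (phase rho v)) in *.
  set (k := 4 * (V ^ 3 * rho)) in *.
  replace (12 * bump_mass * V ^ 3 * rho) with (3 * (k * bump_mass))
    by (unfold k; ring).
  replace (e * (C * c - S * s)) with (e0 * c + (e - e0) * c + e * ((C - 1) * c - S * s))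
    by ring.
  assert (Prod : forall x y, Rabs x <= k -> Rabs y <= bump_mass ->
    Rabs (x * y) <= k * bump_mass).
  { intros x y Hx Hy; rewrite Rabs_mult.
    generalize (Rabs_pos x) (Rabs_pos y); nra. }
  assert (T1 := Prod _ _ H1 Hc); assert (T2 := Prod _ _ H2 Hc); assert (T3 := Prod _ _ H3 Hs).
  apply Rabs_le_between in T1; apply Rabs_le_between in T2; apply Rabs_le_between in T3.
  nra.
Qed.

(** The order of choices matters: [V] is fixed first, by a decay bound uniform in [rho], making the
    tail at most [m / 2]. Then [rho] makes the error on [-V,V] at most [m / 4]. The Gaussian part is
    at least [m], so [I >= m / 4]. *)
Lemma pairing_integrals : exists rho I J : R,
  0 < rho /\ 0 < I /\
  is_RInt_gen (pairing_re rho) (Rbar_locally m_infty) (Rbar_locally p_infty) I /\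
  is_RInt_gen (pairing_im rho) (Rbar_locally m_infty) (Rbar_locally p_infty) J.
Proof.
  destruct bump_transform_decay as [B [HB Hdecay]].
  assert (HM := bump_mass_pos).
  assert (HE := exp_pos (- 2)).
  assert (HPI := PI_RGT_0).
  set (m := bump_mass * exp (- 2)).
  assert (Hm : 0 < m) by (apply Rmult_lt_0_compat; easy).
  (* The cap [PI / 4] ensures [V >= 1]; [B + 1] avoids a division by zero. *)
  set (eta := Rmin (m / (8 * (B + 1))) (PI / 4)).
  assert (Heta0 : 0 < m / (8 * (B + 1))) by (apply Rdiv_lt_0_compat; lra).
  assert (Heta : 0 < eta) by (apply Rmin_pos; lra).
  assert (Heta1 : eta <= PI / 4) by apply Rmin_r.
  assert (Heta2 : eta <= m / (8 * (B + 1))) by apply Rmin_l.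
  set (V := tan (PI / 2 - eta)).
  assert (HV : 1 <= V).
  { unfold V; destruct (Req_dec eta (PI / 4)) as [->|H].
    - replace (PI / 2 - PI / 4) with (PI / 4) by field; rewrite tan_PI4; lra.
    - rewrite <- tan_PI4; apply Rlt_le, tan_increasing; lra. }
  assert (HaV : PI / 2 - atan V = eta) by (unfold V; rewrite atan_tan; lra).
  (* [D * rho] is the pointwise error [12 bump_mass V^3 rho] times the length [2 V]. *)
  set (D := 24 * bump_mass * V ^ 4).
  assert (HV4 : 1 <= V ^ 4) by (apply pow_R1_Rle, HV).
  assert (HD : 0 < D) by (unfold D; nra).
  set (rho := Rmin (m / (4 * D)) (/ V)).
  assert (HiV : 0 < / V) by (apply Rinv_0_lt_compat; lra).
  assert (Hrho0 : 0 < m / (4 * D)) by (apply Rdiv_lt_0_compat; lra).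
  assert (Hrho : 0 < rho) by (apply Rmin_pos; lra).
  assert (Hrho1 : rho <= m / (4 * D)) by apply Rmin_l.
  assert (Hrho2 : rho * V <= 1).
  { apply Rmult_le_reg_r with (/ V); [easy|].
    rewrite Rmult_assoc, Rinv_r, Rmult_1_l, Rmult_1_r by lra; apply Rmin_r. }
  assert (Dre : forall v, Rabs (pairing_re rho v) <= (2 * B) / (1 + v ^ 2)).
  { intros v; destruct (Hdecay v) as [Hc Hs]; unfold Rdiv; rewrite Rmult_assoc.
    now apply Rabs_pairing_re_le. }
  assert (Dim : forall v, Rabs (pairing_im rho v) <= (2 * B) / (1 + v ^ 2)).
  { intros v; destruct (Hdecay v) as [Hc Hs]; unfold Rdiv; rewrite Rmult_assoc.
    now apply Rabs_pairing_im_le. }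
  destruct (improper_integral_inv_sqr _ _ (continuous_pairing_re rho) Dre) as [I [HI HIV]].
  destruct (improper_integral_inv_sqr _ _ (continuous_pairing_im rho) Dim) as [J [HJ _]].
  exists rho, I, J; repeat split; auto.
  assert (Tail := HIV V ltac:(lra)); rewrite HaV in Tail.
  assert (TailB : 2 * (2 * B) * eta <= m / 2).
  { apply Rle_trans with (4 * (B + 1) * (m / (8 * (B + 1)))).
    - apply Rle_trans with (4 * (B + 1) * eta); [nra|].
      apply Rmult_le_compat_l; lra.
    - right; field; lra. }
  assert (Err : D * rho <= m / 4).
  { apply Rle_trans with (D * (m / (4 * D))); [apply Rmult_le_compat_l; lra|].
    right; field; lra. }
  set (gauss := fun v => exp (- (2 * v ^ 2)) * (1 - 2 * v ^ 2)).
  set (E := 12 * bump_mass * V ^ 3 * rho).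
  assert (Cg : forall v, continuous gauss v)
    by (intros v; apply continuous_of_ex_derive; unfold gauss; auto_derive; easy).
  assert (Lower : bump_mass * RInt gauss (- V) V - D * rho <= RInt (pairing_re rho) (- V) V).
  { apply (is_RInt_le (fun v => bump_mass * gauss v - E) (pairing_re rho) (- V) V); [lra| | |].
    - replace (D * rho) with ((V - - V) * E) by (unfold D, E; ring).
      apply (is_RInt_minus (V := R_NormedModule) (fun v => bump_mass * gauss v) (fun _ => E)).
      + apply (is_RInt_scal (V := R_NormedModule) gauss).
        apply (RInt_correct (V := R_CompleteNormedModule)), ex_RInt_continuous_all, Cg.
      + apply (is_RInt_const (V := R_NormedModule)).
    - apply (RInt_correct (V := R_CompleteNormedModule)), ex_RInt_continuous_all.
      apply continuous_pairing_re.
    - intros v Hv.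
      eapply Rle_trans; [|apply (pairing_re_near_gaussian V); auto; apply Rabs_le; lra].
      apply Rplus_le_compat_r; unfold gauss.
      generalize (bump_transform_cos_ge v) (exp_pos (- (2 * v ^ 2))); intros; nra. }
  assert (G : m <= bump_mass * RInt gauss (- V) V)
    by (apply Rmult_le_compat_l; [lra|now apply gaussian_integral_ge]).
  apply Rabs_le_between in Tail; lra.
Qed.

(** * Pairing the kernel with dilated bumps *)

Lemma test_fun_neg_scaled_bump d : 0 < d -> test_fun_neg (fun t => bump (t / d)).
Proof.
  intros Hd; split.
  - intros n t; apply smooth_upto_ex_derive_n.
    apply smooth_upto_ext with (fun t => bump (/ d * t + 0)).
    + intros x; f_equal; field; lra.
    + apply smooth_upto_affine, smooth_upto_bump.
  - exists (- 2 * d), (- 1 * d); split; [lra|].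
    intros t [H|H]; apply bump_out.
    + left; apply Rmult_le_reg_r with d; [easy|].
      unfold Rdiv; rewrite Rmult_assoc, Rinv_l; lra.
    + right; apply Rmult_le_reg_r with d; [easy|].
      unfold Rdiv; rewrite Rmult_assoc, Rinv_l; lra.
Qed.

Lemma is_RInt_scaled_bump (g g' : R -> R) d w : 0 < d ->
  (forall x, is_derive g x (g' x)) ->
  is_RInt (fun t => g (w * t) * bump (t / d)) (- 2 * d) (- 1 * d)
    (d * bump_transform g (d * w)).
Proof.
  intros Hd Dg.
  apply is_RInt_ext with
    (fun t => scal (/ d) (d * (bump (/ d * t + 0) * g (d * w * (/ d * t + 0))))).
  - intros t _; unfold scal; simpl; unfold mult; simpl.
    replace (/ d * t + 0) with (t / d) by (field; lra).
    replace (d * w * (t / d)) with (w * t) by (field; lra).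
    field; lra.
  - apply (is_RInt_comp_lin (V := R_NormedModule)
      (fun u => d * (bump u * g (d * w * u))) (/ d) 0).
    replace (/ d * (- 2 * d) + 0) with (- 2) by (field; lra).
    replace (/ d * (- 1 * d) + 0) with (- 1) by (field; lra).
    apply (is_RInt_scal (V := R_NormedModule) (fun u => bump u * g (d * w * u))).
    now apply (is_RInt_bump_transform g g').
Qed.

(** Compact support reduces the improper integral to a proper one on [[-2 d, -d]], where [u = t / d]
    is substituted; uniqueness then identifies [RInt_gen]. *)
Lemma ift_scaled_bump d w : 0 < d ->
  ift (fun t => RtoC (bump (t / d))) w =
  (RtoC (/ sqrt (2 * PI)) *
   ((d * bump_transform cos (d * w))%R, (- (d * bump_transform sin (d * w)))%R))%C.
Proof.
  intros Hd; unfold ift; f_equal.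
  assert (E : forall t, (Cexp (- (Ci * RtoC (w * t))) * RtoC (bump (t / d)))%C
    = (cos (w * t) * bump (t / d), - (sin (w * t) * bump (t / d)))).
  { intros t; unfold Cexp, Re, Im, Copp, Cmult, Ci, RtoC; simpl fst; simpl snd.
    replace (- (0 * (w * t) - 1 * 0)) with 0 by ring.
    replace (- (0 * 0 + 1 * (w * t))) with (- (w * t)) by ring.
    rewrite exp_0, cos_neg, sin_neg; f_equal; ring. }
  apply (is_RInt_gen_unique (V := C_R_CompleteNormedModule)).
  apply (is_RInt_gen_support (W := C_R_NormedModule)) with (- 2 * d) (- 1 * d).
  - lra.
  - intros t Ht; rewrite E.
    rewrite bump_out.
    + rewrite !Rmult_0_r, Ropp_0; reflexivity.
    + destruct Ht as [H|H]; [left|right]; apply Rmult_le_reg_r with d;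
        unfold Rdiv; rewrite ?Rmult_assoc, ?Rinv_l; lra.
  - apply (is_RInt_fct_extend_pair (U := R_NormedModule) (V := R_NormedModule)).
    + apply is_RInt_ext with (fun t => cos (w * t) * bump (t / d)).
      * intros t _; now rewrite E.
      * apply (is_RInt_scaled_bump cos _ d w Hd is_derive_cos).
    + apply is_RInt_ext with (fun t => opp (sin (w * t) * bump (t / d))).
      * intros t _; now rewrite E.
      * apply (is_RInt_opp (V := R_NormedModule)).
        apply (is_RInt_scaled_bump sin _ d w Hd is_derive_sin).
Qed.

Theorem theorem5 (c0 tau0 : R) (hc0 : 0 < c0) (htau0 : 0 < tau0) :
  ~ kernel_causal c0 tau0.
Proof.
  intros Hcausal.
  destruct pairing_integrals as [rho [I [J [Hrho [HI [HIre HJim]]]]]].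
  (* These choices give [tau0 w = rho (d w)] and [r tau0 w^2 / c0 = 4 (d w)^2], so the symbol at
     distance [r] is the rescaled one in [v = d w]. *)
  set (d := tau0 / rho).
  assert (Hd : 0 < d) by (apply Rdiv_lt_0_compat; easy).
  set (r := 4 * c0 * d ^ 2 / tau0).
  assert (Hr : 0 <= r).
  { apply Rdiv_le_0_compat; [|easy].
    generalize (pow2_ge_0 d); nra. }
  set (k := / sqrt (2 * PI)).
  assert (Hk : 0 < k).
  { apply Rinv_0_lt_compat, sqrt_lt_R0; generalize PI_RGT_0; lra. }
  assert (Hn : norm3 (r, 0, 0) = r).
  { unfold norm3; replace (r ^ 2 + 0 ^ 2 + 0 ^ 2) with (r ^ 2) by ring.
    now apply sqrt_pow2. }
  (* One factor [k] comes from the kernel and one from [ift]; the factor [d] is the Jacobian that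
     [is_RInt_gen_comp_scale] absorbs. *)
  assert (E : forall w, (RtoC k * symbol c0 tau0 (r, 0%R, 0%R) w
      * ift (fun t => RtoC (bump (t / d))) w)%C
    = (k ^ 2 * (d * pairing_re rho (d * w)), k ^ 2 * (d * pairing_im rho (d * w)))).
  { intros w; rewrite symbol_eq, ift_scaled_bump, Hn by easy; fold k; cbv zeta.
    unfold pairing_re, pairing_im, decay_exponent, phase.
    replace (r * tau0 * w ^ 2 / c0) with (4 * (d * w) ^ 2) by (unfold r; field; lra).
    replace (rho * (d * w)) with (tau0 * w) by (unfold d; field; lra).
    unfold Cmult, RtoC, fst, snd; f_equal; ring. }
  (* Causality concerns pairings that converge, so convergence to this value is proved before it is
     forced to vanish. Its real part [k^2 I] is positive. *)
  assert (HL : (k ^ 2 * I, k ^ 2 * J) = RtoC 0).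
  { apply (Hcausal (r, 0, 0) (fun t => bump (t / d)));
      [now apply test_fun_neg_scaled_bump|].
    unfold kernel_pairing; fold k.
    apply is_RInt_gen_pair; try apply Rbar_locally_filter.
    - apply is_RInt_gen_ext with (fun w => scal (k ^ 2) (scal d (pairing_re rho (d * w)))).
      + apply filter_forall; intros ab w _; now rewrite E.
      + apply (is_RInt_gen_scal (V := R_NormedModule)).
        now apply (is_RInt_gen_comp_scale (W := R_NormedModule)).
    - apply is_RInt_gen_ext with (fun w => scal (k ^ 2) (scal d (pairing_im rho (d * w)))).
      + apply filter_forall; intros ab w _; now rewrite E.
      + apply (is_RInt_gen_scal (V := R_NormedModule)).
        now apply (is_RInt_gen_comp_scale (W := R_NormedModule)). }
  apply (f_equal fst) in HL; simpl in HL.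
  assert (0 < k ^ 2 * I) by (apply Rmult_lt_0_compat; [apply pow_lt|]; easy).
  simpl in *; lra.
Qed.
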